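(* Let $(M,g)$ be a smooth, connected, complete Riemannian manifold of dimension $n\ge 2$ and let $\alpha>0$ be a real number. (a) If the sectional curvature and the Ricci curvature of $(M,g)$ satisfy $\sec\ge\alpha$ and $\mathrm{Ric}<n\,\alpha$, then the curvature operator of the second kind $\overset{\circ}{R}:S_0^2M\to S_0^2M$ is strictly positive. (b) If $\sec\ge\alpha$ and $\mathrm{Ric}\le n\,\alpha$, then $\overset{\circ}{R}$ is nonnegative.
   Context: $S_0^2M$ is the bundle of symmetric covariant $2$-tensors $\varphi$ on $M$ with $\mathrm{trace}_g\varphi=0$. The sign convention for the curvature tensor $R_{ijkl}$ is such that $\sec(X,Y)=R(X,Y,X,Y)$ for orthonormal $X,Y$, and the Ricci tensor is $R_{kl}=R^i{}_{kil}$. The curvature operator of the second kind is determined by $\overset{\circ}{R}(\varphi)_{ij}=R_{iklj}\varphi^{kl}$ (indices raised with $g$), regarded as the symmetric bilinear form $(\varphi,\psi)\mapsto g(\overset{\circ}{R}(\varphi),\psi)$ on $S_0^2M$. It is called strictly positive (nonnegative) if at every point all eigenvalues of this bilinear form on $S_0^2M$ are positive (nonnegative). The inequality $\sec\ge\alpha$ is meant for all tangent $2$-planes at all points; $\mathrm{Ric}<c$ (resp. $\mathrm{Ric}\le c$) means $\mathrm{Ric}(X,X)<c\,g(X,X)$ (resp. $\le$) for all nonzero tangent vectors $X$. *)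

(* Defs.v *)
From mathcomp Require Import all_boot all_order all_algebra.
From mathcomp Require Import all_classical all_reals all_analysis.

Set Implicit Arguments.
Unset Strict Implicit.
Unset Printing Implicit Defensive.

Import Order.TTheory GRing.Theory Num.Theory.
Import numFieldNormedType.Exports.

Local Open Scope classical_set_scope.
Local Open Scope ring_scope.

Section Smooth.
Context {R : realType} {n : nat}.
Implicit Types (f : 'rV[R]_n -> R) (x : 'rV[R]_n).

Definition partial (i : 'I_n) f x : R := 'D_(delta_mx 0 i) f x.

Definition iter_partial (s : seq 'I_n) f : 'rV[R]_n -> R := foldr partial f s.

(* C^oo on an open set U: iterated partial derivatives of every order exist
   and are (Frechet) differentiable, hence continuous, at every point of U.
   Since 'D_v is a total operator, "exists" has to be asserted; it is contained
   in the differentiability of the partial derivatives of one order less. *)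
Definition smooth_on (U : set 'rV[R]_n) f : Prop :=
  forall (s : seq 'I_n) x, U x -> differentiable (iter_partial s f) x.

End Smooth.

(* Tensor calculus in one coordinate system: [g y] is the matrix of components
   of the metric at the coordinate point [y].  Tensors at [x] are given by
   their components in the coordinate basis; tangent vectors are row vectors.
   Here (g^{ij}) = invmx (g x). *)
Section Coordinates.
Context {R : realType} {n : nat}.
Variables (g : 'rV[R]_n -> 'M[R]_n) (x : 'rV[R]_n).

Definition metric_form (X Y : 'rV[R]_n) : R :=
  \sum_i \sum_j g x i j * X 0 i * Y 0 j.

(* Gamma^k_{ij} = 1/2 g^{kl} (d_i g_{jl} + d_j g_{il} - d_l g_{ij}) *)
Definition christoffel_at (y : 'rV[R]_n) (k i j : 'I_n) : R :=
  2^-1 * \sum_l invmx (g y) k l *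
    (partial i (fun z => g z j l) y + partial j (fun z => g z i l) y
     - partial l (fun z => g z i j) y).

(* The component on d_l of R(d_i, d_j) d_k, where
   R(X,Y)Z = D_X D_Y Z - D_Y D_X Z - D_[X,Y] Z for the Levi-Civita
   connection D. *)
Definition riemann13 (i j k l : 'I_n) : R :=
  partial i (fun z => christoffel_at z l j k) x
  - partial j (fun z => christoffel_at z l i k) x
  + \sum_m (christoffel_at x m j k * christoffel_at x l i m
            - christoffel_at x m i k * christoffel_at x l j m).

(* R_{ijkl} = g(R(d_i, d_j) d_l, d_k), so that sec(X,Y) = R(X,Y,X,Y); on the
   unit sphere R_{ijkl} = g_{ik} g_{jl} - g_{il} g_{jk}. *)
Definition riemann (i j k l : 'I_n) : R :=
  \sum_m g x k m * riemann13 i j l m.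

Definition riemann_form (X Y Z W : 'rV[R]_n) : R :=
  \sum_i \sum_j \sum_k \sum_l
    riemann i j k l * X 0 i * Y 0 j * Z 0 k * W 0 l.

Definition orthonormal_pair (X Y : 'rV[R]_n) : Prop :=
  [/\ metric_form X X = 1, metric_form Y Y = 1 & metric_form X Y = 0].

(* The sectional curvature of the plane spanned by an orthonormal pair X, Y. *)
Definition sec (X Y : 'rV[R]_n) : R := riemann_form X Y X Y.

(* R_{kl} = R^i_{kil} = g^{ij} R_{jkil} *)
Definition ricci (k l : 'I_n) : R :=
  \sum_i \sum_j invmx (g x) i j * riemann j k i l.

Definition ricci_form (X Y : 'rV[R]_n) : R :=
  \sum_k \sum_l ricci k l * X 0 k * Y 0 l.

(* phi^{kl} = g^{ka} g^{lb} phi_{ab} *)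
Definition raise (phi : 'M[R]_n) (k l : 'I_n) : R :=
  \sum_a \sum_b invmx (g x) k a * invmx (g x) l b * phi a b.

Definition tensor_form (phi psi : 'M[R]_n) : R :=
  \sum_i \sum_j raise phi i j * psi i j.

Definition metric_trace (phi : 'M[R]_n) : R :=
  \sum_i \sum_j invmx (g x) i j * phi i j.

(* The fibre of S_0^2 M *)
Definition S20 : set 'M[R]_n :=
  [set phi | phi^T = phi /\ metric_trace phi = 0].

(* Rcirc(phi)_{ij} = R_{iklj} phi^{kl}; it need not be traceless even if phi
   is, which is why it is used through the bilinear form below. *)
Definition Rcirc (phi : 'M[R]_n) : 'M[R]_n :=
  \matrix_(i, j) \sum_k \sum_l riemann i k l j * raise phi k l.

Definition Rcirc_form (phi psi : 'M[R]_n) : R := tensor_form (Rcirc phi) psi.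

End Coordinates.

(* [l] is an eigenvalue of the bilinear form [B], restricted to the linear
   subspace [S], with respect to the inner product [ip]. *)
Definition form_eigenvalue (R : realType) (V : lmodType R) (S : set V)
    (B ip : V -> V -> R) (l : R) : Prop :=
  exists phi : V, [/\ S phi, phi != 0 &
    forall psi, S psi -> B phi psi = l * ip phi psi].

(* A smooth n-manifold given by a smooth atlas. *)
Record smoothManifold (R : realType) (n : nat) := SmoothManifold {
  carrier :> topologicalType;
  carrier_hausdorff : hausdorff_space carrier;
  carrier_second_countable : @second_countable carrier;
  chart : Type;
  cdom : chart -> set carrier;
  cmap : chart -> carrier -> 'rV[R]_n;
  cinv : chart -> 'rV[R]_n -> carrier;
  cdom_open : forall c, open (cdom c);
  cimg_open : forall c, open (cmap c @` cdom c);
  cdom_cover : forall p, exists c, cdom c p;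
  cmapK : forall c p, cdom c p -> cinv c (cmap c p) = p;
  cmap_continuous : forall c, {within cdom c, continuous (cmap c)};
  cinv_continuous : forall c, {within cmap c @` cdom c, continuous (cinv c)};
  transition_smooth : forall c d k,
    smooth_on (cmap c @` (cdom c `&` cdom d))
      (fun y => cmap d (cinv c y) 0 k) }.

Definition cimg (R : realType) (n : nat) (M : smoothManifold R n)
    (c : chart M) : set 'rV[R]_n := cmap c @` cdom c.

(* A Riemannian metric is given by its components in every chart of the atlas,
   subject to the transformation law of covariant 2-tensors. *)
Record riemannianManifold (R : realType) (n : nat) := RiemannianManifold {
  manifold :> smoothManifold R n;
  metric : chart manifold -> 'rV[R]_n -> 'M[R]_n;
  metric_smooth : forall c i j,
    smooth_on (cimg c) (fun y => metric c y i j);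
  metric_symmetric : forall (c : chart manifold) y, cimg c y ->
    (metric c y)^T = metric c y;
  metric_posdef : forall (c : chart manifold) y, cimg c y ->
    forall X, X != 0 -> 0 < metric_form (metric c) y X X;
  metric_transition : forall (c d : chart manifold) y,
    (cmap c @` (cdom c `&` cdom d)) y ->
    let tau := fun z => cmap d (cinv c z) in
    forall i j, metric c y i j =
      \sum_a \sum_b partial i (fun z => tau z 0 a) y
                    * partial j (fun z => tau z 0 b) y
                    * metric d (tau y) a b }.

Section Global.
Context {R : realType} {n : nat}.
Variable M : riemannianManifold R n.

Definition curve_coord (c : chart M) (gamma : R -> M) (k : 'I_n) (t : R) : R :=
  cmap c (gamma t) 0 k.

(* A geodesic parametrized by the whole real line *)
Definition geodesic_line (gamma : R -> M) : Prop :=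
  continuous gamma /\
  forall (c : chart M) (t : R), cdom c (gamma t) ->
    let u := curve_coord c gamma in
    let u' := fun k => derive1 (u k) in
    forall k, [/\ derivable (u k) t 1, derivable (u' k) t 1 &
      derive1 (u' k) t
      + \sum_i \sum_j christoffel_at (metric c) (cmap c (gamma t)) k i j
                      * u' i t * u' j t = 0].

(* Geodesic completeness: every initial position p and velocity X (components
   in the chart c) is realized by a geodesic defined for all times. *)
Definition complete_manifold : Prop :=
  forall (c : chart M) (p : M) (X : 'rV[R]_n), cdom c p ->
    exists gamma, [/\ geodesic_line gamma, gamma 0 = p &
      forall k, derivable (curve_coord c gamma k) 0 1 /\
                derive1 (curve_coord c gamma k) 0 = X 0 k].

Definition connected_manifold : Prop := connected [set: M].

(* The conditions below are stated in every chart around every point; they do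
   not depend on the chart since all the objects involved are tensors. *)

(* Every tangent 2-plane is spanned by an orthonormal pair. *)
Definition sec_ge (a : R) : Prop :=
  forall (c : chart M) (p : M), cdom c p -> forall X Y,
    orthonormal_pair (metric c) (cmap c p) X Y ->
    a <= sec (metric c) (cmap c p) X Y.

Definition Ric_lt (a : R) : Prop :=
  forall (c : chart M) (p : M), cdom c p -> forall X, X != 0 ->
    ricci_form (metric c) (cmap c p) X X
      < a * metric_form (metric c) (cmap c p) X X.

Definition Ric_le (a : R) : Prop :=
  forall (c : chart M) (p : M), cdom c p -> forall X, X != 0 ->
    ricci_form (metric c) (cmap c p) X X
      <= a * metric_form (metric c) (cmap c p) X X.

Definition Rcirc_eigenvalue (c : chart M) (p : M) (l : R) : Prop :=
  let g := metric c in let x := cmap c p in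
  form_eigenvalue (S20 g x) (Rcirc_form g x) (tensor_form g x) l.

Definition Rcirc_strictly_positive : Prop :=
  forall (c : chart M) (p : M), cdom c p ->
    forall l, Rcirc_eigenvalue c p l -> 0 < l.

Definition Rcirc_nonnegative : Prop :=
  forall (c : chart M) (p : M), cdom c p ->
    forall l, Rcirc_eigenvalue c p l -> 0 <= l.

End Global.

(* Main.v *)
Require Import Defs.
From mathcomp Require Import all_boot all_order all_algebra.
From mathcomp Require Import all_classical all_reals all_analysis.
From mathcomp Require Import ring lra.
Import Order.TTheory GRing.Theory Num.Theory.
Import numFieldNormedType.Exports.
Local Open Scope classical_set_scope.
Local Open Scope ring_scope.

(** At a point, diagonalize a traceless symmetric [phi] in a [g]-orthonormal
    frame [e_a], with eigenvalues [lam_a] and [K_ab = sec(e_a, e_b)].  The skew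
    symmetries of the curvature tensor give
    [Rcirc(phi, phi) = - \sum_ab lam_a lam_b K_ab
                     = 1/2 \sum_ab K_ab (lam_a - lam_b)^2 - \sum_a Ric(e_a, e_a) lam_a^2],
    and since [\sum_ab (lam_a - lam_b)^2 = 2 n \sum_a lam_a^2] for a traceless
    [phi], [K_ab >= alpha] yields
    [Rcirc(phi, phi) >= \sum_a (n alpha - Ric(e_a, e_a)) lam_a^2].
    Taking for [phi] an eigenvector bounds the eigenvalue from below. *)

(** * Symmetry of mixed directional derivatives *)

Lemma is_derive_line {R : realType} {V : normedModType R} {f : V -> R} {y u : V} {s : R} :
  derivable f (s *: u + y) u ->
  is_derive s (1 : R) (fun t => f (t *: u + y)) ('D_u f (s *: u + y)).
Proof.
have e : (fun h : R => h^-1 *: (((fun t => f (t *: u + y)) \o shift s) (h *: (1 : R))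
            - f (s *: u + y)))
  = (fun h => h^-1 *: ((f \o shift (s *: u + y)) (h *: u) - f (s *: u + y))).
  by apply/funext => h /=; rewrite [h%:A]mulr1 scalerDl addrA.
move=> df; apply: DeriveDef; first by rewrite /derivable e.
by rewrite /derive e.
Qed.

Lemma MVT_line {R : realType} {V : normedModType R} {f : V -> R} {y u : V} {h : R} :
  0 < h -> (forall s, 0 <= s <= h -> derivable f (s *: u + y) u) ->
  exists2 s, 0 <= s <= h & f (h *: u + y) - f y = h * 'D_u f (s *: u + y).
Proof.
move=> h0 df.
have [||s] := @MVT R (fun t => f (t *: u + y)) (fun t => 'D_u f (t *: u + y)) 0 h h0.
- by move=> s; rewrite in_itv/= => /andP[s0 sh]; apply/is_derive_line/df; rewrite !ltW.
- apply: derivable_within_continuous => s; rewrite in_itv/= => /df /is_derive_line.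
  by case.
rewrite in_itv/= scale0r add0r subr0 => /andP[s0 sh] ->.
by exists s; rewrite ?ltW// mulrC.
Qed.

(** The mean value theorem is used twice: in direction [u] for the difference of [f] along two
    opposite sides of the parallelogram, then in direction [v] for ['D_u f]. The intermediate point
    is only located inside the parallelogram, which suffices once the mixed derivative is
    continuous. *)
Lemma second_difference {R : realType} {V : normedModType R} {f : V -> R} {x u v : V} {h : R} :
  0 < h ->
  (forall s t, 0 <= s <= h -> 0 <= t <= h ->
     derivable f (s *: u + (t *: v + x)) u /\
     derivable ('D_u f) (s *: u + (t *: v + x)) v) ->
  exists s t, [/\ 0 <= s <= h, 0 <= t <= h &
    f (h *: u + (h *: v + x)) - f (h *: u + x) - (f (h *: v + x) - f x) =
    h * h * 'D_v ('D_u f) (s *: u + (t *: v + x))].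
Proof.
move=> h0 df.
have h0h : 0 <= h <= h by rewrite lexx ltW.
have o0h : 0 <= (0 : R) <= h by rewrite lexx ltW.
pose phi : R -> R := (fun t => f (t *: u + (h *: v + x))) - (fun t => f (t *: u + x)).
have dphi s : 0 <= s <= h ->
    is_derive s (1 : R) phi
      ('D_u f (s *: u + (h *: v + x)) - 'D_u f (s *: u + x)).
  move=> sh; apply: is_deriveB; apply: is_derive_line; first exact: (df _ _ sh h0h).1.
  by have [+ _] := df _ _ sh o0h; rewrite scale0r add0r.
have [s s01||s] := @MVT R phi
  (fun s => 'D_u f (s *: u + (h *: v + x)) - 'D_u f (s *: u + x)) 0 h h0.
- by apply: dphi; move: s01; rewrite in_itv/= => /andP[? ?]; rewrite !ltW.
- by apply: derivable_within_continuous => s; rewrite in_itv/= => /dphi[].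
rewrite in_itv/= => /andP[s0 sh] mvt.
have s0h : 0 <= s <= h by rewrite !ltW.
have [|t t0h mvt2] := @MVT_line R V ('D_u f) (s *: u + x) v h h0.
  by move=> t t0h; rewrite addrCA; have [] := df _ _ s0h t0h.
exists s, t; split; [exact: s0h|exact: t0h|].
have {mvt} : f (h *: u + (h *: v + x)) - f (h *: u + x)
    - (f (0 *: u + (h *: v + x)) - f (0 *: u + x)) =
    ('D_u f (s *: u + (h *: v + x)) - 'D_u f (s *: u + x)) * (h - 0) := mvt.
rewrite scale0r !add0r subr0 => ->; rewrite [s *: u + (h *: v + x)]addrCA mvt2.
by rewrite [s *: u + (t *: v + x)]addrCA mulrC mulrA.
Qed.

Lemma near_parallelogram {R : realType} {V : normedModType R} {x : V} (u v : V) {P : V -> Prop} :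
  (\forall y \near x, P y) ->
  exists2 h : R, 0 < h & forall s t, 0 <= s <= h -> 0 <= t <= h -> P (s *: u + (t *: v + x)).
Proof.
move=> /nbhs_normP[e /= e0 xP].
(* The summand 1 keeps the denominator positive even if [u] and [v] both vanish. *)
have k0 : 0 < `|u| + `|v| + 1 by rewrite ltr_wpDl// addr_ge0.
exists (e / (`|u| + `|v| + 1)) => [|s t /andP[s0 sh] /andP[t0 th]]; first by rewrite divr_gt0.
apply: xP => /=; rewrite addrA opprD addrCA subrr addr0 normrN.
apply: (le_lt_trans (ler_normD _ _)); rewrite !normrZ !ger0_norm//.
apply: (@le_lt_trans _ _ (e / (`|u| + `|v| + 1) * (`|u| + `|v|))).
  by rewrite mulrDr lerD// ler_wpM2r.
by rewrite mulrAC -mulrA gtr_pMr// ltr_pdivrMr// mul1r ltrDl.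
Qed.

(** The second difference over a parallelogram is symmetric in [u] and [v]. So for small [h] the two
    mixed derivatives agree when taken at two suitable points near [x]; by continuity each differs
    by at most [e / 2] from its value at [x]. *)
Lemma derive_comm {R : realType} {V : normedModType R} {f : V -> R} {x u v : V} :
  (\forall y \near x, [/\ derivable f y u, derivable f y v,
     derivable ('D_u f) y v & derivable ('D_v f) y u]) ->
  {for x, continuous ('D_v ('D_u f))} -> {for x, continuous ('D_u ('D_v f))} ->
  'D_v ('D_u f) x = 'D_u ('D_v f) x.
Proof.
move=> df cvu cuv; apply/eqP; rewrite -subr_eq0 -normr_le0; apply/ler_addgt0Pl => e e0.
have e2 : 0 < e / 2 by rewrite divr_gt0.
move/cvgr_dist_le : cvu => /(_ _ e2) cvu; move/cvgr_dist_le : cuv => /(_ _ e2) cuv.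
have [h h0 hP] := near_parallelogram u v (filterI df (filterI cvu cuv)).
have [s [t [s0h t0h fuv]]] : exists s t, [/\ 0 <= s <= h, 0 <= t <= h &
    f (h *: u + (h *: v + x)) - f (h *: u + x) - (f (h *: v + x) - f x) =
    h * h * 'D_v ('D_u f) (s *: u + (t *: v + x))].
  by apply: second_difference => // s t s0h t0h; have [[]] := hP _ _ s0h t0h.
have [t' [s' [t0h' s0h' fvu]]] : exists t s, [/\ 0 <= t <= h, 0 <= s <= h &
    f (h *: v + (h *: u + x)) - f (h *: v + x) - (f (h *: u + x) - f x) =
    h * h * 'D_u ('D_v f) (t *: v + (s *: u + x))].
  apply: second_difference => // t' s' t0h' s0h'; rewrite addrCA.
  by have [[]] := hP _ _ s0h' t0h'.
have /(mulfI _) eqD : h * h * 'D_v ('D_u f) (s *: u + (t *: v + x)) =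
    h * h * 'D_u ('D_v f) (s' *: u + (t' *: v + x)).
  by rewrite -fuv [in RHS]addrCA -fvu [in RHS]addrCA; ring.
have {}eqD := eqD (lt0r_neq0 (mulr_gt0 h0 h0)).
have [_ [/= d1 _]] := hP _ _ s0h t0h; have [_ [/= _ d2]] := hP _ _ s0h' t0h'.
rewrite eqD in d1; rewrite distrC in d2.
rewrite addr0 (splitr e).
apply: le_trans (lerD d1 d2).
exact: ler_distD.
Qed.

(** * Differentiability of determinants and of the inverse matrix *)

Lemma differentiable_sumP {R : realType} {V : normedModType R} {I : Type} {r : seq I}
    {P : pred I} {F : I -> V -> R} {x : V} :
  (forall i, differentiable (F i) x) -> differentiable (fun y => \sum_(i <- r | P i) F i y) x.
Proof.
move=> dF; elim: r => [|i r IHr].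
  by under eq_fun do rewrite big_nil; exact: differentiable_cst.
under eq_fun do rewrite big_cons /=; case: (P i) => //.
exact: (differentiableD (dF i) IHr).
Qed.

Lemma differentiable_prodP {R : realType} {V : normedModType R} {I : Type} {r : seq I}
    {P : pred I} {F : I -> V -> R} {x : V} :
  (forall i, differentiable (F i) x) -> differentiable (fun y => \prod_(i <- r | P i) F i y) x.
Proof.
move=> dF; elim: r => [|i r IHr].
  by under eq_fun do rewrite big_nil; exact: differentiable_cst.
under eq_fun do rewrite big_cons /=; case: (P i) => //.
exact: (differentiableM (dF i) IHr).
Qed.

Lemma differentiable_det {R : realType} {V : normedModType R} {n : nat} {A : V -> 'M[R]_n}
    {x : V} :
  (forall i j, differentiable (fun y => A y i j) x) -> differentiable (fun y => \det (A y)) x.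
Proof.
move=> dA; apply: differentiable_sumP => s.
apply: (@differentiableM _ _ (cst _)); first exact: differentiable_cst.
exact: differentiable_prodP.
Qed.

(** Cramer's rule writes the entry as a cofactor over the determinant. As [invmx] returns its
    argument on singular matrices, that formula is valid only where [A y] is invertible, and a
    derivative at [x] needs this on a whole neighbourhood. *)
Lemma derivable_invmx {R : realType} {V : normedModType R} {n : nat} {A : V -> 'M[R]_n}
    {x : V} (v : V) (i j : 'I_n) :
  (\forall y \near x, A y \in unitmx) -> (forall i j, differentiable (fun y => A y i j) x) ->
  derivable (fun y => invmx (A y) i j) x v.
Proof.
move=> uA dA.
apply: (@near_eq_derivable _ _ _ (fun y =>
    (\det (A y))^-1 * ((-1) ^+ (j + i) * \det (row' j (col' i (A y)))))).
  by near=> y; rewrite /invmx (near uA y)// !mxE.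
apply: diff_derivable; apply: differentiableM.
  apply: differentiableV; first exact: differentiable_det.
  by have := nbhs_singleton uA; rewrite unitmxE unitfE.
apply: (@differentiableM _ _ (cst _)); first exact: differentiable_cst.
by apply: differentiable_det => k l; under eq_fun do rewrite !mxE.
Unshelve. all: by end_near. Qed.

Lemma is_derive_sumP {R : realType} {V : normedModType R} {n : nat}
    {F : 'I_n -> V -> R} {dF : 'I_n -> R} {x v : V} :
  (forall i, is_derive x v (F i) (dF i)) ->
  is_derive x v (fun y => \sum_i F i y) (\sum_i dF i).
Proof.
move=> HF; have -> : (fun y => \sum_i F i y) = \sum_i F i.
  by apply/funext => y; rewrite fct_sumE.
exact: is_derive_sum.
Qed.

(** * Skew symmetry of the curvature tensor in its last two indices *)

Section CurvatureSymmetry.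
Context {R : realType} {n : nat}.
Variables (g : 'rV[R]_n -> 'M[R]_n) (U : set 'rV[R]_n).
Hypothesis oU : open U.
Hypothesis smooth_g : forall i j, smooth_on U (fun y => g y i j).
Hypothesis g_sym : forall y, U y -> (g y)^T = g y.
Hypothesis g_unit : forall y, U y -> g y \in unitmx.

Lemma partial_comm {f : 'rV[R]_n -> R} {x : 'rV[R]_n} (i j : 'I_n) :
  smooth_on U f -> U x -> partial i (partial j f) x = partial j (partial i f) x.
Proof.
move=> sf Ux; apply: derive_comm.
- near=> y; have Uy : U y by near: y; exact: open_nbhs_nbhs.
  by split; apply: diff_derivable;
    [exact: (sf [::])|exact: (sf [::])|exact: (sf [:: j])|exact: (sf [:: i])].
- exact: differentiable_continuous (sf [:: i; j] x Ux).
- exact: differentiable_continuous (sf [:: j; i] x Ux).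
Unshelve. all: by end_near. Qed.

(* Christoffel symbols of the first kind, Gamma_{k,ij} *)
Definition christoffel1 (y : 'rV[R]_n) (k i j : 'I_n) : R :=
  2^-1 * (partial i (fun z => g z j k) y + partial j (fun z => g z i k) y
          - partial k (fun z => g z i j) y).

(** [christoffel_at] is [invmx (g y)] applied to a column, so multiplication by [g y] cancels the
    inverse. The curvature can then be rewritten with first-kind symbols, whose derivatives are
    second partials of [g]. *)
Lemma lower_christoffel {y} k i j : U y ->
  \sum_m g y k m * christoffel_at g y m i j = christoffel1 y k i j.
Proof.
move=> Uy.
pose E : 'cV[R]_n := \col_l (partial i (fun z => g z j l) y + partial j (fun z => g z i l) y
     - partial l (fun z => g z i j) y).
have GE m : christoffel_at g y m i j = 2^-1 * (invmx (g y) *m E) m 0.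
  by rewrite /christoffel_at mxE; congr (_ * _); apply: eq_bigr => l _; rewrite mxE.
have -> : christoffel1 y k i j = 2^-1 * (g y *m (invmx (g y) *m E)) k 0.
  by rewrite mulKVmx ?g_unit// mxE.
rewrite [(_ *m _) k 0]mxE mulr_sumr; apply: eq_bigr => m _.
by rewrite GE mulrCA.
Qed.

Lemma partial_sym {y} a i j : U y ->
  partial a (fun z => g z i j) y = partial a (fun z => g z j i) y.
Proof.
move=> Uy; apply: near_eq_derive; near=> z.
have Uz : U z by near: z; exact: open_nbhs_nbhs.
by rewrite -{1}(g_sym _ Uz) mxE.
Unshelve. all: by end_near. Qed.

(** This is the coordinate form of D g = 0: in the sum, the derivatives along [k] and [l] cancel. *)
Lemma metric_compatibility {y} j k l : U y ->
  christoffel1 y k j l + christoffel1 y l j k = partial j (fun z => g z k l) y.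
Proof.
move=> Uy; rewrite /christoffel1 (partial_sym j l k)//.
by field.
Qed.

Lemma smooth_differentiable {y} i j : U y -> differentiable (fun z => g z i j) y.
Proof. exact: (smooth_g i j [::]). Qed.

Lemma smooth_partial_differentiable {y} a i j :
  U y -> differentiable (partial a (fun z => g z i j)) y.
Proof. exact: (smooth_g i j [:: a]). Qed.

Lemma derivable_christoffel {y} m i j v :
  U y -> derivable (fun z => christoffel_at g z m i j) y v.
Proof.
move=> Uy; apply: derivableM; first exact: derivable_cst.
pose F l z := invmx (g z) m l * (partial i (fun z => g z j l) z + partial j (fun z => g z i l) z
     - partial l (fun z => g z i j) z).
have dF l : derivable (F l) y v.
  apply: derivableM.
    apply: derivable_invmx => [|a b]; last exact: smooth_differentiable.
    by near=> z; apply: g_unit; near: z; exact: open_nbhs_nbhs.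
  apply: diff_derivable; apply: differentiableB; first apply: differentiableD;
    exact: smooth_partial_differentiable.
by case: (is_derive_sumP (fun l => derivableP (dF l))).
Unshelve. all: by end_near. Qed.

(** The identity of [lower_christoffel] holds on the open set [U], so it may be differentiated by
    the Leibniz rule. The second summand is the one that occurs in [riemann]. *)
Lemma derive_lower_christoffel {x} a k i j : U x ->
  partial a (fun y => christoffel1 y k i j) x =
  \sum_m (partial a (fun y => g y k m) x * christoffel_at g x m i j
          + g x k m * partial a (fun y => christoffel_at g y m i j) x).
Proof.
move=> Ux.
have near_U : \forall y \near x, U y by exact: open_nbhs_nbhs.
rewrite /partial -(@near_eq_derive _ _ _ (fun y => \sum_m g y k m * christoffel_at g y m i j));
  last by near=> y; apply: lower_christoffel; near: y.
apply: derive_val; apply: is_derive_sumP => m.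
rewrite addrC [X in _ + X]mulrC.
apply: is_deriveM; apply: derivableP.
  exact/diff_derivable/smooth_differentiable.
exact: derivable_christoffel.
Unshelve. all: by end_near. Qed.

Lemma derive_christoffel1 {x} a k i j : U x ->
  partial a (fun y => christoffel1 y k i j) x =
  2^-1 * (partial a (partial i (fun z => g z j k)) x
          + partial a (partial j (fun z => g z i k)) x
          - partial a (partial k (fun z => g z i j)) x).
Proof.
move=> Ux.
have d b c e : is_derive x (delta_mx 0 a) (partial b (fun z => g z c e))
    (partial a (partial b (fun z => g z c e)) x).
  exact/derivableP/diff_derivable/smooth_partial_differentiable.
rewrite {1}/partial; apply: derive_val.
Qed.

(** In terms of the Levi-Civita connection D, this is g(D_i d_k, D_j d_l); its symmetry below is the
    symmetry of [g]. *)
Definition christoffel_product x i k j l := \sum_m christoffel1 x m i k * christoffel_at g x m j l.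

Lemma christoffel_product_sym {x} i k j l : U x -> christoffel_product x i k j l = christoffel_product x j l i k.
Proof.
move=> Ux; rewrite /christoffel_product.
under eq_bigr => m _ do rewrite -lower_christoffel// mulr_suml.
under [in RHS]eq_bigr => m _ do rewrite -lower_christoffel// mulr_suml.
rewrite exchange_big; apply: eq_bigr => m _; apply: eq_bigr => p _.
by rewrite -{1}(g_sym _ Ux) mxE mulrAC.
Qed.

(** Moving [g] inside the derivative of a Christoffel symbol costs a term with a derivative of [g],
    which [metric_compatibility] splits in two. One half cancels the quadratic terms of [riemann13],
    the other is a [christoffel_product]. *)
Lemma riemann_christoffel1 {x} i j k l : U x ->
  riemann g x i j k l =
    partial i (fun y => christoffel1 y k j l) x - partial j (fun y => christoffel1 y k i l) x
    - christoffel_product x i k j l + christoffel_product x j k i l.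
Proof.
move=> Ux; rewrite /riemann /riemann13.
have sumG a b c : \sum_m christoffel_at g x m b c * christoffel1 x k a m =
    \sum_m g x k m * \sum_p christoffel_at g x p b c * christoffel_at g x m a p.
  under eq_bigr => m _ do rewrite -lower_christoffel// mulr_sumr.
  rewrite exchange_big; apply: eq_bigr => m _; rewrite mulr_sumr.
  by apply: eq_bigr => p _; rewrite mulrCA.
have sum_dG a b c : \sum_m g x k m * partial a (fun z => christoffel_at g z m b c) x =
    partial a (fun y => christoffel1 y k b c) x
    - \sum_m christoffel_at g x m b c * christoffel1 x k a m - christoffel_product x a k b c.
  rewrite derive_lower_christoffel// /christoffel_product -!sumrB; apply: eq_bigr => m _ /=.
  by rewrite -metric_compatibility//; ring.
have distr (G A B C D : 'I_n -> R) : \sum_m G m * (A m - B m + (C m - D m)) =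
    \sum_m G m * A m - \sum_m G m * B m + (\sum_m G m * C m - \sum_m G m * D m).
  by rewrite -!sumrB -big_split; apply: eq_bigr => m _ /=; rewrite mulrDr !mulrBr.
under eq_bigr => m _ do rewrite sumrB.
have congr4 (a b c d a' b' c' d' : R) : a = a' -> b = b' -> c = c' -> d = d' ->
  a - b + (c - d) = a' - b' + (c' - d') by move=> -> -> -> ->.
apply: (etrans (distr _ _ _ _ _)).
apply: (etrans (congr4 _ _ _ _ _ _ _ _ (sum_dG i j l) (sum_dG j i l)
  (esym (sumG i j l)) (esym (sumG j i l)))).
move: (\sum_m _) (\sum_m _) (partial _ _ _) (partial _ _ _) => A B C D; ring.
Qed.

(** In the sum of both sides of [riemann_christoffel1] for (k, l) and (l, k), metric compatibility
    turns the derivative terms into the commutator of two partials of g_{kl}, which is zero, and the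
    four products cancel in pairs by [christoffel_product_sym]. *)
Lemma riemann_skew34 {x} i j k l : U x -> riemann g x i j k l = - riemann g x i j l k.
Proof.
move=> Ux.
have dG a b : partial a (fun y => christoffel1 y k b l) x + partial a (fun y => christoffel1 y l b k) x
    = partial a (partial b (fun z => g z k l)) x.
  rewrite !derive_christoffel1//.
  have -> : partial a (partial b (fun z => g z k l)) x = partial a (partial b (fun z => g z l k)) x.
    apply: near_eq_derive; near=> y; apply: partial_sym; near: y; exact: open_nbhs_nbhs.
  have avg (p q r : R) : 2^-1 * (p + q - r) + 2^-1 * (p + r - q) = p by field.
  exact: avg.
have dGij := etrans (dG i j) (etrans (partial_comm i j (smooth_g k l) Ux) (esym (dG j i))).
apply: (etrans (riemann_christoffel1 i j k l Ux)).
apply: (etrans _ (congr1 -%R (esym (riemann_christoffel1 i j l k Ux)))).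
have skew (A B C D p q p' q' : R) : A + B = C + D -> p = q' -> q = p' ->
  A - C - p + q = - (B - D - p' + q') by move=> /(canRL (addrK _)) -> -> ->; ring.
exact: (skew _ _ _ _ _ _ _ _ dGij (christoffel_product_sym i k j l Ux) (christoffel_product_sym j k i l Ux)).
Unshelve. all: by end_near. Qed.

End CurvatureSymmetry.

Lemma riemann_skew12 {R : realType} {n : nat} (g : 'rV[R]_n -> 'M[R]_n) (x : 'rV[R]_n) i j k l :
  riemann g x i j k l = - riemann g x j i k l.
Proof.
rewrite /riemann -sumrN; apply: eq_bigr => m _; rewrite -mulrN /riemann13 opprD opprB.
by rewrite -sumrN; congr (_ * (_ + _)); apply: eq_bigr => p _; rewrite opprB.
Qed.

(** * Orthonormal frames and diagonalization of symmetric forms *)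

Lemma orthonormal_frame {R : rcfType} {n : nat} {g : 'M[R]_n} {k : nat} :
  g^T = g -> (forall X : 'rV_n, X != 0 -> 0 < (X *m g *m X^T) 0 0) -> (k <= n)%N ->
  exists P : 'M[R]_(k, n), P *m g *m P^T = 1%:M.
Proof.
move=> gT gpos; elim: k => [_|k IHk kn].
  by exists 0; apply/matrixP => -[].
have [P PgP] := IHk (ltnW kn).
(* Gram-Schmidt step: [g *m P^T] has only [k < n] columns, so some nonzero [v] is [g]-orthogonal to
   all rows found so far; it is then normalized and appended. *)
have /rowV0Pn[v /sub_kermxP vgP v0] : kermx (g *m P^T) != 0.
  rewrite -mxrank_eq0 mxrank_ker subn_eq0 -ltnNge.
  exact: leq_ltn_trans (rank_leq_col _) kn.
pose s := Num.sqrt ((v *m g *m v^T) 0 0).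
have s0 : 0 < s by rewrite sqrtr_gt0 gpos.
have ss : s * s = (v *m g *m v^T) 0 0 by rewrite -expr2 sqr_sqrtr// ltW// gpos.
pose u := s^-1 *: v.
have ugP : u *m g *m P^T = 0 by rewrite -!scalemxAl -mulmxA vgP scaler0.
have Pgu : P *m g *m u^T = 0.
  by apply/trmx_inj; rewrite trmx0 !trmx_mul trmxK gT mulmxA.
have ugu : u *m g *m u^T = 1%:M.
  apply/matrixP => i j; rewrite !ord1 linearZ/= -!scalemxAl -scalemxAr.
  rewrite scalerA [LHS]mxE -ss mxE eqxx.
  by rewrite /=; field; rewrite gt_eqF.
rewrite -(addn1 k); exists (col_mx P u).
by rewrite tr_col_mx mul_col_mx mul_col_row PgP ugP Pgu ugu -scalar_mx_block.
Qed.

(** Dividing by small positive and small negative [t] bounds [K] from both sides in the limit. The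
    hypothesis is the shape that the gain of a maximized function takes along a rotation with
    rational parameter [t]. *)
Lemma first_order_condition {R : realFieldType} {K D : R} :
  (forall t, t * (K * (1 - t ^+ 2) - t * D) <= 0) -> K = 0.
Proof.
move=> h; apply/eqP/negPn/negP => K0.
have KD : 0 < 2 * (`|K| + `|D|) by rewrite mulr_gt0// ltr_wpDr// normr_gt0.
(* With this [r], both [|K * r|] and [r * D] are at most 1/2, so at [t = K * r] the factor
   [1 - t ^+ 2 - r * D] is at least 1/4 and the hypothesis fails. *)
pose r := (2 * (`|K| + `|D|))^-1.
have r0 : 0 < r by rewrite invr_gt0.
have rr : r * (`|K| + `|D|) = 2^-1.
  by rewrite /r invfM -mulrA mulVf ?mulr1// gt_eqF// ltr_wpDr// normr_gt0.
have rK : `|K * r| <= 2^-1.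
  by rewrite normrM (gtr0_norm r0) -rr mulrC ler_pM2l// lerDl.
have rK2 : (K * r) ^+ 2 <= 4^-1.
  rewrite -real_normK ?num_real//; apply: (@le_trans _ _ (2^-1 ^+ 2)); last by lra.
  by rewrite lerXn2r// nnegrE// ltW.
have rD : r * D <= 2^-1.
  by rewrite -rr ler_pM2l// (le_trans (ler_norm D))// lerDr.
have := h (K * r); apply/negP; rewrite -ltNge.
have -> : K * r * (K * (1 - (K * r) ^+ 2) - K * r * D) =
    K ^+ 2 * r * (1 - (K * r) ^+ 2 - r * D) by ring.
apply: mulr_gt0; first by rewrite mulr_gt0// exprn_even_gt0.
move: rK2 rD; move: (_ ^+ 2) (r * D) => p q. lra.
Qed.

Section BilinearEntry.
Context {R : comNzRingType} {n : nat}.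
Implicit Types (S : 'M[R]_n) (u v w : 'rV[R]_n).

Definition bilin S u v : R := (u *m S *m v^T) 0 0.

Lemma bilinDl S u v w : bilin S (u + v) w = bilin S u w + bilin S v w.
Proof. by rewrite /bilin !mulmxDl mxE. Qed.

Lemma bilinDr S u v w : bilin S u (v + w) = bilin S u v + bilin S u w.
Proof. by rewrite /bilin linearD /= mulmxDr mxE. Qed.

Lemma bilinZl S (c : R) u w : bilin S (c *: u) w = c * bilin S u w.
Proof. by rewrite /bilin -!scalemxAl mxE. Qed.

Lemma bilinZr S (c : R) u w : bilin S u (c *: w) = c * bilin S u w.
Proof. by rewrite /bilin linearZ/= -scalemxAr mxE. Qed.

Lemma bilin_row {m} (P : 'M[R]_(m, n)) S i j :
  bilin S (row i P) (row j P) = (P *m S *m P^T) i j.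
Proof. by rewrite /bilin -row_mul [LHS]mxE [RHS]mxE; apply: eq_bigr => k _; rewrite !mxE. Qed.

Lemma bilin_delta S i j : bilin S (delta_mx 0 i) (delta_mx 0 j) = S i j.
Proof. by rewrite /bilin trmx_delta -rowE -colE !mxE. Qed.

End BilinearEntry.

Definition bilinE {R : comNzRingType} {n : nat} :=
  (@bilinDl R n, @bilinDr R n, @bilinZl R n, @bilinZr R n, @bilin_delta R n).

(** A rotation in the coordinate plane of [a] and [b]. It is given by rows so that [bilin_row] and
    [bilinE] evaluate the entries of a conjugated matrix, and by [c] and [s] instead of an angle so
    that a rational parametrization can be used. *)
Definition givens {R : comNzRingType} {n : nat} (a b : 'I_n) (c s : R) : 'M[R]_n :=
  \matrix_i (if i == a then c *: delta_mx 0 a + s *: delta_mx 0 b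
             else if i == b then c *: delta_mx 0 b + - s *: delta_mx 0 a
             else delta_mx 0 i).

Lemma givens_orthogonal {R : comNzRingType} {n : nat} {a b : 'I_n} {c s : R} :
  a != b -> c ^+ 2 + s ^+ 2 = 1 -> givens a b c s *m (givens a b c s)^T = 1%:M.
Proof.
move=> ab cs; apply/matrixP => i j.
rewrite -[X in X *m _]mulmx1 -bilin_row !rowK.
have c2 : c ^+ 2 = 1 - s ^+ 2 by rewrite -cs addrK.
have neq (k l : 'I_n) : k != l -> ((k == l) = false) * ((l == k) = false).
  by move=> kl; split; apply/negbTE; rewrite // eq_sym.
have [->|/neq ia] := eqVneq i a; last have [->|/neq ib] := eqVneq i b;
  (have [->|/neq ja] := eqVneq j a; last have [->|/neq jb] := eqVneq j b);
  rewrite !bilinE !mxE ?eqxx ?(neq _ _ ab) ?ia ?ib ?ja ?jb /=; try ring: c2.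
Qed.

(** Only the diagonal entries at [a] and [b] change, and their sum is preserved; what one gains the
    other loses, hence the factor [w a - w b]. *)
Lemma givens_diag_sum {R : comNzRingType} {n : nat} {a b : 'I_n} {c s : R} (w : 'I_n -> R)
    {S : 'M[R]_n} :
  a != b -> c ^+ 2 + s ^+ 2 = 1 -> S^T = S ->
  \sum_i w i * (givens a b c s *m S *m (givens a b c s)^T) i i = \sum_i w i * S i i
    + (w a - w b) * s * (2 * c * S a b - s * (S a a - S b b)).
Proof.
move=> ab cs ST.
have Sba : S b a = S a b by rewrite -{1}ST mxE.
rewrite (bigD1 a)//= (bigD1 b) 1?eq_sym//= [in RHS](bigD1 a)//= [in RHS](bigD1 b) 1?eq_sym//=.
rewrite -!bilin_row !rowK eqxx eq_sym (negbTE ab) eqxx.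
rewrite (eq_bigr (fun i => w i * S i i)); last first.
  by move=> i /andP[ia ib]; rewrite -bilin_row rowK (negbTE ia) (negbTE ib) bilin_delta.
rewrite !bilinE Sba.
have c2 : c ^+ 2 = 1 - s ^+ 2 by rewrite -cs addrK.
ring: c2.
Qed.

(** The spectral theorem by a variational argument: the diagonal of [Q *m S *m Q^T], weighted by the
    pairwise distinct numbers 0, ..., n - 1, has a maximum over the compact orthogonal group. At a
    maximum no plane rotation gives a gain, and to first order this kills each off-diagonal
    entry. *)
Lemma orthogonal_diagonalization {R : realType} {n : nat} {S : 'M[R]_n} : S^T = S ->
  exists2 Q : 'M[R]_n, Q *m Q^T = 1%:M & is_diag_mx (Q *m S *m Q^T).
Proof.
move=> ST.
(* Matrices are flattened to row vectors, where closed bounded sets are known to be compact. *)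
pose W (v : 'rV[R]_(n * n)) : 'M[R]_n := vec_mx v.
have WK Q : W (mxvec Q) = Q by exact: mxvecK.
have entry_cont i j : continuous (fun v : 'rV[R]_(n * n) => W v i j : R).
  have -> : (fun v : 'rV[R]_(n * n) => W v i j) = (fun v => v 0 (mxvec_index i j)).
    by apply/funext => v; rewrite [LHS]mxE.
  exact: coord_continuous.
have mul_cont (F G : 'rV[R]_(n * n) -> R) :
    continuous F -> continuous G -> continuous (fun v => F v * G v).
  by move=> cF cG v; exact: continuousM (cF v) (cG v).
have sum_cont k (F : 'I_k -> 'rV[R]_(n * n) -> R) :
    (forall i, continuous (F i)) -> continuous (fun v => \sum_i F i v).
  move=> cF v; rewrite /continuous_at; elim: (index_enum _) => [|i r IHr].
    by under eq_fun do rewrite big_nil; rewrite big_nil; exact: (@cst_continuous _ R 0 v).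
  under eq_fun do rewrite big_cons; rewrite big_cons; apply: cvgD IHr; exact: (cF i v).
(* The orthogonal group, stated entrywise so that it is an intersection of preimages of points under
   continuous functions. *)
pose A := [set v : 'rV[R]_(n * n) | forall i j, \sum_k W v i k * W v j k = (i == j)%:R].
have AP v : A v <-> W v *m (W v)^T = 1%:M.
  split=> [Av|Av i j].
    apply/matrixP => i j; rewrite mxE [RHS]mxE -Av.
    by apply: eq_bigr => k _; rewrite [_^T _ _]mxE.
  move/matrixP/(_ i j) : Av; rewrite mxE [RHS]mxE => <-.
  by apply: eq_bigr => k _; rewrite [_^T _ _]mxE.
pose f (v : 'rV[R]_(n * n)) : R :=
  \sum_(i < n) (i%:R : R) * (W v *m S *m (W v)^T) i i.
have cptA : compact A.
  apply: bounded_closed_compact.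
    exists 1; split=> // x x1 v Av /=.
    rewrite [leLHS]/Num.norm /= mx_normrE.
    apply/bigmax_leP; split=> [|[i0 k] _ /=]; first by rewrite ltW// (lt_trans ltr01).
    rewrite ord1; case/mxvec_indexP: k => i j.
    have <- : W v i j = v 0 (mxvec_index i j) by rewrite [LHS]mxE.
    (* Rows have unit length, so every entry has absolute value at most 1. *)
    have := Av i i; rewrite eqxx mulr1n (bigD1 j)//= => vij.
    rewrite (le_trans _ (ltW x1))// -(@ler_pXn2r _ 2)// ?nnegrE// expr1n real_normK ?num_real//.
    by rewrite expr2 -vij lerDl sumr_ge0// => k _; rewrite -expr2 sqr_ge0.
  have -> : A = \bigcap_(i in [set: 'I_n]) \bigcap_(j in [set: 'I_n])
      (fun v : 'rV[R]_(n * n) => \sum_k W v i k * W v j k) @^-1` [set (i == j)%:R].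
    by apply/seteqP; split=> v Av; [move=> i _ j _; exact: Av|move=> i j; exact: Av].
  apply: closed_bigI => i _; apply: closed_bigI => j _.
  apply: preimage_closed; last exact: closed_eq.
  by move=> v _; apply: (sum_cont _) => k w; exact: mul_cont (entry_cont i k) (entry_cont j k) w.
have cf : continuous f.
  have -> : f = (fun v => \sum_(i < n) \sum_k \sum_l
      (i%:R : R) * (W v i l * S l k * W v i k)).
    apply/funext => v; apply: eq_bigr => i _; rewrite mxE mulr_sumr.
    apply: eq_bigr => k _; rewrite mxE mulr_suml mulr_sumr.
    by apply: eq_bigr => l _; rewrite [_^T _ _]mxE.
  apply: (sum_cont _) => i; apply: (sum_cont _) => k; apply: (sum_cont _) => l v.
  apply: (mul_cont) (@cst_continuous _ R _) _ v; apply: (mul_cont) (entry_cont i k).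
  exact: mul_cont (entry_cont i l) (@cst_continuous _ R _).
have [|v] := compact_EVT_max _ cptA (continuous_subspaceT cf).
  by exists (mxvec 1%:M); apply/AP; rewrite WK trmx1 mulmx1.
rewrite inE => /AP; set Q := W v => QQ vmax.
exists Q => //; apply/is_diag_mxP => a b ab.
set T := Q *m S *m Q^T.
have TT : T^T = T by rewrite !trmx_mul trmxK ST mulmxA.
(* The weights of [a] and [b] differ, so this factor can be cancelled. *)
suff : (a%:R - b%:R : R) * T a b = 0.
  by move/eqP; rewrite mulf_eq0 subr_eq0 eqr_nat (negbTE ab) => /eqP.
apply: (@first_order_condition _ _ ((a%:R - b%:R) * (T a a - T b b))) => t.
have t1 : 0 < 1 + t ^+ 2 by rewrite ltr_wpDr// sqr_ge0.
(* Rational parametrization of the unit circle, with [t = 0] giving the identity rotation. *)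
pose c := (1 - t ^+ 2) / (1 + t ^+ 2); pose s := 2 * t / (1 + t ^+ 2).
have cs : c ^+ 2 + s ^+ 2 = 1 by rewrite /c /s; field; rewrite gt_eqF.
have := vmax (mxvec (givens a b c s *m Q)).
rewrite inE => /(_ _)/wrap[].
  apply/AP; rewrite WK trmx_mul mulmxA -(mulmxA _ Q) QQ mulmx1.
  exact: givens_orthogonal.
rewrite /f WK.
have -> : givens a b c s *m Q *m S *m (givens a b c s *m Q)^T =
   givens a b c s *m T *m (givens a b c s)^T by rewrite trmx_mul !mulmxA.
rewrite (givens_diag_sum (fun i : 'I_n => i%:R)) ?TT// gerDl.
have -> : (a%:R - b%:R) * s * (2 * c * T a b - s * (T a a - T b b)) =
  4 / (1 + t ^+ 2) ^+ 2 * (t * ((a%:R - b%:R) * T a b * (1 - t ^+ 2) -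
     t * ((a%:R - b%:R) * (T a a - T b b)))).
  by rewrite /c /s; field; rewrite gt_eqF.
by rewrite pmulr_rle0// divr_gt0// exprn_gt0.
Qed.

(** An orthonormal frame is chosen first; the orthogonal change of frame that then diagonalizes
    [phi] keeps it orthonormal. *)
Lemma simultaneous_diagonalization {R : realType} {n : nat} {g phi : 'M[R]_n} :
  g^T = g -> (forall X : 'rV_n, X != 0 -> 0 < (X *m g *m X^T) 0 0) -> phi^T = phi ->
  exists2 P : 'M[R]_n, P *m g *m P^T = 1%:M & is_diag_mx (P *m phi *m P^T).
Proof.
move=> gT gpos phiT; have [P PgP] := orthonormal_frame gT gpos (leqnn n).
have [|Q QQ Qdiag] := @orthogonal_diagonalization _ _ (P *m phi *m P^T).
  by rewrite !trmx_mul trmxK phiT mulmxA.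
have QP (X : 'M[R]_n) : Q *m P *m X *m (Q *m P)^T = Q *m (P *m X *m P^T) *m Q^T.
  by rewrite trmx_mul !mulmxA.
by exists (Q *m P); rewrite QP// PgP mulmx1.
Qed.

(** * The pinching inequality for eigenvalues and sectional curvatures *)

Lemma sum_pinching {R : realFieldType} {n : nat} {lam : 'I_n -> R} {K : 'I_n -> 'I_n -> R}
    {alpha : R} :
  \sum_a lam a = 0 -> (forall a b, K a b = K b a) -> (forall a b, a != b -> alpha <= K a b) ->
  \sum_a lam a ^+ 2 * (n%:R * alpha - \sum_b K b a) <=
  - \sum_a \sum_b lam a * lam b * K a b.
Proof.
move=> lam0 Ksym Kge.
have sum_sqr : \sum_a \sum_b alpha * (lam a - lam b) ^+ 2 =
    2 * \sum_a lam a ^+ 2 * (n%:R * alpha).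
  have e a : \sum_b alpha * (lam a - lam b) ^+ 2 =
      lam a ^+ 2 * (n%:R * alpha) + alpha * \sum_b lam b ^+ 2.
    (* The cross term is isolated as a multiple of [\sum_b lam b], which vanishes. *)
    transitivity (\sum_(b < n) lam a ^+ 2 * alpha + (alpha * \sum_b lam b ^+ 2
        - 2 * alpha * lam a * \sum_b lam b)).
      by rewrite !mulr_sumr -sumrB -big_split; apply: eq_bigr => b _ /=; ring.
    by rewrite lam0 mulr0 subr0 sumr_const card_ord -mulr_natl; congr (_ + _); ring.
  under eq_bigr => a _ do rewrite e.
  rewrite big_split/= sumr_const card_ord -[X in _ + X = _]mulr_natl mulr2n mulrDl mul1r.
  by congr (_ + _); rewrite !mulr_sumr; apply: eq_bigr => a _; ring.
have sum_K : \sum_a \sum_b K a b * (lam a - lam b) ^+ 2 =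
    2 * \sum_a lam a ^+ 2 * \sum_b K b a - 2 * \sum_a \sum_b lam a * lam b * K a b.
  have -> : 2 * \sum_a lam a ^+ 2 * \sum_b K b a =
      \sum_a \sum_b K a b * lam a ^+ 2 + \sum_a \sum_b K a b * lam b ^+ 2.
    rewrite mulr2n mulrDl mul1r; congr (_ + _).
      apply: eq_bigr => a _; rewrite mulr_sumr.
      by apply: eq_bigr => b _; rewrite (Ksym a) mulrC.
    rewrite exchange_big; apply: eq_bigr => a _; rewrite mulr_sumr.
    by apply: eq_bigr => b _; rewrite mulrC.
  rewrite -big_split mulr_sumr -sumrB; apply: eq_bigr => a _ /=.
  rewrite -big_split mulr_sumr -sumrB; apply: eq_bigr => b _ /=.
  by ring.
have : \sum_a \sum_b alpha * (lam a - lam b) ^+ 2 <= \sum_a \sum_b K a b * (lam a - lam b) ^+ 2.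
  apply: ler_sum => a _; apply: ler_sum => b _.
  (* For [a = b] both sides carry a zero factor, so the bound on [K] enters only off the
     diagonal. *)
  have [->|ab] := eqVneq a b; first by rewrite subrr expr0n/= !mulr0.
  by rewrite ler_wpM2r ?sqr_ge0// Kge.
rewrite sum_sqr sum_K -mulrBr ler_pM2l// => h.
under eq_bigr => a _ do rewrite mulrBr.
by rewrite sumrB lerBlDl.
Qed.

(** * Curvature and tensor norms in an orthonormal frame *)

Lemma bilin_sum {R : comNzRingType} {n : nat} (S : 'M[R]_n) (X Y : 'rV[R]_n) :
  bilin S X Y = \sum_i \sum_j S i j * X 0 i * Y 0 j.
Proof.
rewrite /bilin mxE [RHS]exchange_big; apply: eq_bigr => j _.
by rewrite mxE mulr_suml mxE; apply: eq_bigr => i _; rewrite [S i j * _]mulrC.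
Qed.

Lemma exchange_big2 {R : nmodType} {I J K L : finType} (f : I -> J -> K -> L -> R) :
  \sum_i \sum_j \sum_k \sum_l f i j k l = \sum_k \sum_l \sum_i \sum_j f i j k l.
Proof.
under eq_bigr => i _ do rewrite exchange_big.
rewrite exchange_big; apply: eq_bigr => k _; rewrite [RHS]exchange_big; apply: eq_bigr => i _.
exact: exchange_big.
Qed.

Section Frame.
Context {R : realType} {n : nat} {g : 'rV[R]_n -> 'M[R]_n} {x : 'rV[R]_n}.

Hypothesis skew34 : forall i j k l, riemann g x i j k l = - riemann g x i j l k.

Lemma riemann_form_skew34 X Y Z W :
  riemann_form g x X Y Z W = - riemann_form g x X Y W Z.
Proof.
rewrite /riemann_form -sumrN; apply: eq_bigr => i _; rewrite -sumrN; apply: eq_bigr => j _.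
rewrite exchange_big -sumrN; apply: eq_bigr => k _; rewrite -sumrN; apply: eq_bigr => l _.
by rewrite skew34; ring.
Qed.

Lemma riemann_form_skew12 X Y Z W :
  riemann_form g x X Y Z W = - riemann_form g x Y X Z W.
Proof.
rewrite /riemann_form exchange_big -sumrN; apply: eq_bigr => i _; rewrite -sumrN.
apply: eq_bigr => j _; rewrite -sumrN; apply: eq_bigr => k _; rewrite -sumrN.
by apply: eq_bigr => l _; rewrite riemann_skew12; ring.
Qed.

Context {P : 'M[R]_n}.
Hypothesis PgP : P *m g x *m P^T = 1%:M.

(** A one-sided inverse of a square matrix is two-sided, so [P^T] can be moved to the front of
    [PgP]. *)
Lemma frame_inverse : invmx (g x) = P^T *m P.
Proof.
have PPg : P^T *m P *m g x = 1%:M by rewrite -mulmxA; exact: mulmx1C.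
have gu : g x \in unitmx by have [] := mulmx1_unit PPg.
by apply: (can_inj (mulmxK gu)); rewrite PPg mulVmx.
Qed.

(** Contracting with a tensor that is diagonal in the frame reduces to the values of [F] on the
    pairs (e_a, e_a). It serves for the inverse metric, with all [lam a] equal to 1, and for the
    raised [phi]. *)
Lemma frame_contraction (lam : 'I_n -> R) (H F : 'I_n -> 'I_n -> R) :
  (forall i j, H i j = \sum_a lam a * P a i * P a j) ->
  \sum_i \sum_j F i j * H i j = \sum_a lam a * \sum_i \sum_j F i j * P a i * P a j.
Proof.
move=> HE; under [RHS]eq_bigr => a _ do rewrite mulr_sumr.
rewrite [RHS]exchange_big; apply: eq_bigr => i _.
under [RHS]eq_bigr => a _ do rewrite mulr_sumr.
rewrite [RHS]exchange_big; apply: eq_bigr => j _.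
by rewrite HE mulr_sumr; apply: eq_bigr => a _; ring.
Qed.

Lemma frame_inverse_entry i j : invmx (g x) i j = \sum_a 1 * P a i * P a j.
Proof. by rewrite frame_inverse mxE; apply: eq_bigr => a _; rewrite mxE mul1r. Qed.

(** The inverse metric is contracted in the frame, leaving R(e_a, X, e_a, X). Here [sec] stands for
    that expression for an arbitrary [X], and the rest of the proof only reorders sums. *)
Lemma frame_ricci X :
  ricci_form g x X X = \sum_a sec g x (row a P) X.
Proof.
have ricciE k l : ricci g x k l = \sum_a \sum_i \sum_j riemann g x j k i l * P a i * P a j.
  transitivity (\sum_i \sum_j riemann g x j k i l * invmx (g x) i j).
    by apply: eq_bigr => i _; apply: eq_bigr => j _; rewrite mulrC.
  rewrite (frame_contraction (fun=> 1) _ _ frame_inverse_entry).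
  by apply: eq_bigr => a _; rewrite mul1r.
rewrite /ricci_form; under eq_bigr => k _ do under eq_bigr => l _ do rewrite ricciE !mulr_suml.
under eq_bigr => k _ do rewrite exchange_big.
rewrite exchange_big; apply: eq_bigr => a _.
rewrite /sec /riemann_form.
transitivity (\sum_k \sum_l \sum_j \sum_i riemann g x j k i l * P a i * P a j * X 0 k * X 0 l).
  apply: eq_bigr => k _; apply: eq_bigr => l _; rewrite mulr_suml mulr_suml exchange_big.
  by apply: eq_bigr => j _; rewrite mulr_suml mulr_suml; apply: eq_bigr => i _.
under eq_bigr => k _ do rewrite exchange_big.
rewrite exchange_big; apply: eq_bigr => j _; apply: eq_bigr => k _.
rewrite exchange_big; apply: eq_bigr => i _; apply: eq_bigr => l _.
by rewrite !mxE; ring.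
Qed.

(** By symmetry of the inverse metric, the raising of indices moves to the second argument, where
    [frame_contraction] can use it. *)
Lemma tensor_form_adjoint (A B : 'M[R]_n) :
  tensor_form g x A B = \sum_i \sum_j A i j * raise g x B i j.
Proof.
have gi_sym i j : invmx (g x) i j = invmx (g x) j i.
  by rewrite !frame_inverse_entry; apply: eq_bigr => a _; rewrite mulrAC.
rewrite /tensor_form /raise.
transitivity (\sum_i \sum_j \sum_a \sum_b invmx (g x) i a * invmx (g x) j b * A a b * B i j).
  apply: eq_bigr => i _; apply: eq_bigr => j _; rewrite mulr_suml.
  by apply: eq_bigr => a _; rewrite mulr_suml.
rewrite exchange_big2; apply: eq_bigr => a _; apply: eq_bigr => b _.
rewrite mulr_sumr; apply: eq_bigr => i _; rewrite mulr_sumr; apply: eq_bigr => j _.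
by rewrite (gi_sym i) (gi_sym j); ring.
Qed.

(** Two contractions in the frame leave R(e_a, e_b, e_b, e_a); the minus sign comes from exchanging
    the last two arguments. *)
Lemma frame_Rcirc (lam : 'I_n -> R) phi :
  (forall i j, raise g x phi i j = \sum_a lam a * P a i * P a j) ->
  Rcirc_form g x phi phi =
  - \sum_a \sum_b lam a * lam b * sec g x (row a P) (row b P).
Proof.
move=> raiseE; rewrite /Rcirc_form tensor_form_adjoint (frame_contraction _ _ _ raiseE) -sumrN.
apply: eq_bigr => a _.
have RcircE i j : Rcirc g x phi i j =
    \sum_b lam b * \sum_k \sum_l riemann g x i k l j * P b k * P b l.
  by rewrite mxE (frame_contraction _ _ (fun k l => riemann g x i k l j) raiseE).
under eq_bigr => i _ do under eq_bigr => j _ do rewrite RcircE !mulr_suml.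
under eq_bigr => i _ do rewrite exchange_big.
rewrite exchange_big mulr_sumr -sumrN; apply: eq_bigr => b _ /=.
rewrite /sec riemann_form_skew34 mulrN opprK -mulrA; congr (_ * _).
rewrite /riemann_form mulr_sumr; apply: eq_bigr => i _.
transitivity (\sum_j \sum_k \sum_l lam b * (riemann g x i k l j * P a i * P b k * P b l * P a j)).
  apply: eq_bigr => j _; rewrite mulr_sumr !mulr_suml; apply: eq_bigr => k _.
  by rewrite mulr_sumr !mulr_suml; apply: eq_bigr => l _; ring.
rewrite exchange_big mulr_sumr; apply: eq_bigr => k _.
rewrite exchange_big mulr_sumr; apply: eq_bigr => l _; rewrite mulr_sumr.
by apply: eq_bigr => j _; rewrite !mxE.
Qed.

Context {phi : 'M[R]_n} {d : 'rV[R]_n}.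
Hypothesis phi_diag : P *m phi *m P^T = diag_mx d.

(** With g^{-1} = P^T P, raising both indices of [phi] gives P^T (P phi P^T) P, whose middle factor
    is diagonal. *)
Lemma frame_raise i j : raise g x phi i j = \sum_a d 0 a * P a i * P a j.
Proof.
transitivity ((P^T *m (P *m phi *m P^T) *m P) i j).
  transitivity ((invmx (g x) *m phi *m (invmx (g x))^T) i j).
    rewrite /raise mxE exchange_big; apply: eq_bigr => b _; rewrite mxE mulr_suml.
    by apply: eq_bigr => a _; rewrite [_^T _ _]mxE; ring.
  by rewrite frame_inverse trmx_mul trmxK !mulmxA.
rewrite phi_diag mul_mx_diag mxE; apply: eq_bigr => a _.
by rewrite !mxE; ring.
Qed.

Lemma frame_diag_entry a : \sum_i \sum_j phi i j * P a i * P a j = d 0 a.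
Proof.
have := bilin_row P phi a a; rewrite bilin_sum phi_diag [in RHS]mxE eqxx mulr1n => <-.
by apply: eq_bigr => i _; apply: eq_bigr => j _; rewrite !mxE.
Qed.

Lemma frame_tensor_norm : tensor_form g x phi phi = \sum_a d 0 a ^+ 2.
Proof.
rewrite tensor_form_adjoint (frame_contraction _ _ _ frame_raise).
by apply: eq_bigr => a _; rewrite frame_diag_entry expr2.
Qed.

Lemma frame_trace : metric_trace g x phi = \sum_a d 0 a.
Proof.
transitivity (\sum_i \sum_j phi i j * invmx (g x) i j).
  by apply: eq_bigr => i _; apply: eq_bigr => j _; rewrite mulrC.
rewrite (frame_contraction _ _ _ frame_inverse_entry).
by apply: eq_bigr => a _; rewrite frame_diag_entry mul1r.
Qed.

Lemma frame_diag_neq0 : phi != 0 -> d != 0.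
Proof.
have [Pu PTu] : P \in unitmx /\ P^T \in unitmx by have [] := mulmx1_unit PgP; rewrite unitmx_tr.
apply: contra => /eqP d0; apply/eqP.
apply: (can_inj (mulKmx Pu)); apply: (can_inj (mulmxK PTu)).
by rewrite phi_diag d0 mulmx0 mul0mx linear0.
Qed.

Lemma frame_orthonormal a b : metric_form g x (row a P) (row b P) = (a == b)%:R.
Proof. by rewrite /metric_form -(bilin_sum (g x)) bilin_row PgP mxE. Qed.

Lemma frame_pinching {alpha : R} :
  (forall X Y, orthonormal_pair g x X Y -> alpha <= sec g x X Y) -> metric_trace g x phi = 0 ->
  \sum_a d 0 a ^+ 2 * (n%:R * alpha - ricci_form g x (row a P) (row a P)) <=
  Rcirc_form g x phi phi.
Proof.
move=> sec_ge tr0; rewrite (frame_Rcirc _ _ frame_raise).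
under eq_bigr => a _ do rewrite frame_ricci.
apply: (@sum_pinching _ _ (d 0) (fun a b => sec g x (row a P) (row b P))).
- by rewrite -frame_trace.
(* Exchanging both pairs of arguments changes the sign twice. *)
- by move=> a b; rewrite /sec riemann_form_skew12 riemann_form_skew34 opprK.
- by move=> a b ab; apply: sec_ge; split; rewrite frame_orthonormal ?eqxx ?(negbTE ab).
Qed.

End Frame.

(** * From the frame inequality to bounds on eigenvalues *)

Theorem lemma1 (R : realType) (n : nat) (hn : (2 <= n)%N)
    (M : riemannianManifold R n)
    (hconn : connected_manifold M) (hcompl : complete_manifold M)
    (alpha : R) (halpha : 0 < alpha) :
  (sec_ge M alpha -> Ric_lt M (n%:R * alpha) -> Rcirc_strictly_positive M) /\
  (sec_ge M alpha -> Ric_le M (n%:R * alpha) -> Rcirc_nonnegative M).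
Proof.
(* The pointwise estimate shared by (a) and (b). The rows of [P] are recorded as nonzero because the
   Ricci bounds are stated for nonzero vectors. *)
have diag (c : chart M) (p : M) : cdom c p -> sec_ge M alpha ->
  forall l, Rcirc_eigenvalue c p l -> exists (P : 'M[R]_n) (d : 'rV[R]_n),
    let ric a := ricci_form (metric c) (cmap c p) (row a P) (row a P) in
    [/\ d != 0, forall a, row a P != 0,
      forall a, metric_form (metric c) (cmap c p) (row a P) (row a P) = 1 &
      \sum_a d 0 a ^+ 2 * (n%:R * alpha - ric a) <= l * \sum_a d 0 a ^+ 2].
  move=> cp secM l [phi [[phiT tr0] phi0 eigen]].
  have Uy : cimg c (cmap c p) by exists p.
  have gpos y (X : 'rV[R]_n) : cimg c y -> X != 0 -> 0 < (X *m metric c y *m X^T) 0 0.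
    by move=> Uy' X0; have := metric_posdef Uy' X0; rewrite /metric_form -(bilin_sum (metric c y)).
  have gunit y : cimg c y -> metric c y \in unitmx.
    (* A nonzero vector in the kernel of the metric would have length zero. *)
    move=> Uy'; rewrite -row_free_unit -kermx_eq0; apply/rowV0P => v /sub_kermxP vg.
    apply/eqP; apply: contraT => v0; have := gpos _ _ Uy' v0.
    by rewrite vg mul0mx mxE ltxx.
  have [P PgP /diag_mxP[d phid]] := simultaneous_diagonalization (metric_symmetric Uy) (fun X => gpos _ X Uy) phiT.
  have skew := fun i j k l => riemann_skew34 _ _ (@cimg_open _ _ M c) (@metric_smooth _ _ M c)
     (@metric_symmetric _ _ M c) gunit i j k l Uy.
  exists P, d; split.
  - by apply: (frame_diag_neq0 PgP phid).
  - move=> a; apply/eqP => r0; have := frame_orthonormal PgP a a.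
    rewrite r0 eqxx /metric_form big1 => [/eqP|i _]; first by rewrite eq_sym oner_eq0.
    by rewrite big1// => j _; rewrite !mxE !mulr0.
  - by move=> a; rewrite (frame_orthonormal PgP) eqxx.
  (* The eigenvalue equation is tested on [phi] itself, so that [l] times its squared norm becomes
     [Rcirc_form] at [phi]. *)
  - rewrite -(frame_tensor_norm PgP phid) -eigen//.
    exact: (frame_pinching skew PgP phid (secM c p cp) tr0).
have sum_gt0 (d : 'rV[R]_n) (F : 'I_n -> R) :
    d != 0 -> (forall a, 0 < F a) -> 0 < \sum_a d 0 a ^+ 2 * F a.
  move=> /rV0Pn[a da] F0; rewrite (bigD1 a)//=.
  apply: ltr_pwDl; first by rewrite mulr_gt0// exprn_even_gt0.
  by apply: sumr_ge0 => b _; rewrite mulr_ge0 ?sqr_ge0// ltW.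
have norm_gt0 (d : 'rV[R]_n) : d != 0 -> 0 < \sum_a d 0 a ^+ 2.
  by move=> /(sum_gt0 _ (fun=> 1))/(_ (fun=> ltr01)); under eq_bigr do rewrite mulr1.
split=> secM ricM c p cp l eig; have [P [d [d0 P0 P1 le]]] := diag c p cp secM l eig.
(* The sign of [l] is that of its product with the positive squared norm; each Ricci gap is positive
   on the unit vectors [row a P]. *)
- rewrite -(pmulr_lgt0 _ (norm_gt0 _ d0)); apply: lt_le_trans le; apply: sum_gt0 => // a.
  by have := ricM c p cp _ (P0 a); rewrite P1 mulr1 subr_gt0.
- rewrite -(pmulr_lge0 _ (norm_gt0 _ d0)); apply: le_trans le; apply: sumr_ge0 => a _.
  have := ricM c p cp _ (P0 a); rewrite P1 mulr1 -subr_ge0.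
  exact: mulr_ge0 (sqr_ge0 _).
Qed.
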